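(* Let $m, r\geq 1$ and $k\geq 0$ be integers and let $\mathcal{K} = \langle K_1,\dots, K_r\rangle$ be a collectively unavoidable (i.e. collectively $r$-unavoidable) family of simplicial subcomplexes of $2^{[m]}$. Assume moreover that $K_i$ is $(m,k)$-balanced for each $i=1,\dots,r$ (with the same $k$ for all $i$). Then the symmetrized deleted join $\mathrm{SymmDelJoin}(\mathcal{K}) = \mathrm{SymmDelJoin}(K_1,\dots,K_r)$ is $(m-r-1)$-connected.
   Context: Notation: $[m]=\{1,\dots,m\}$; $2^{[m]}$ is the full simplex on $m$ vertices (all subsets of $[m]$); $\binom{[m]}{\leqslant k}$ is the family of all subsets of $[m]$ with at most $k$ elements. A simplicial complex $K\subseteq 2^{[m]}$ is a family of subsets closed under taking subsets and containing the empty set. A simplicial complex $K\subseteq 2^{[m]}$ is $(m,k)$-balanced if $\binom{[m]}{\leqslant k}\subseteq K\subseteq \binom{[m]}{\leqslant k+1}$. An ordered $r$-tuple $\langle K_1,\dots,K_r\rangle$ of subcomplexes of $2^{[m]}$ is collectively $r$-unavoidable (collectively unavoidable) if for each ordered collection $(A_1,\dots,A_r)$ of pairwise disjoint (possibly empty) subsets of $[m]$ there exists $i$ such that $A_i\in K_i$. The $r$-fold join $(2^{[m]})^{\ast r}$ is the simplicial complex on $r$ disjoint copies of $[m]$ whose simplices are $A_1\sqcup\dots\sqcup A_r$, where $A_i$ is a subset of the $i$-th copy of $[m]$. The deleted join $K_1\ast_\Delta\dots\ast_\Delta K_r\subseteq (2^{[m]})^{\ast r}$ consists of the simplices $A_1\sqcup\dots\sqcup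 A_r$ such that the sets $A_1,\dots,A_r\subseteq[m]$ are pairwise disjoint and $A_i\in K_i$ for each $i$. The symmetrized deleted join is $$\mathrm{SymmDelJoin}(K_1,\dots,K_r)=\bigcup_{\pi\in S_r}K_{\pi(1)}\ast_\Delta\dots\ast_\Delta K_{\pi(r)}\subseteq (2^{[m]})^{\ast r},$$ where $S_r$ is the symmetric group on $r$ elements. A complex is called $n$-connected if its geometric realization is; by convention $(-1)$-connected means non-empty, and for $n\leq -2$ the condition is void. *)

(* Defs.v *)
From HB Require Import structures.
From mathcomp Require Import all_boot all_order all_algebra all_fingroup.
From mathcomp Require Import all_classical all_reals all_analysis.
Import Order.TTheory GRing.Theory Num.Theory.
Import numFieldNormedType.Exports.

Set Implicit Arguments.
Unset Strict Implicit.
Unset Printing Implicit Defensive.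

Local Open Scope ring_scope.

(* A vertex v : V need not belong to the complex ([set v] may be a non-face),
   but the empty set is always a face.  The vertex set [m] is 'I_m. *)
Definition simplicial_complex (V : finType) (K : {set {set V}}) : Prop :=
  finset.set0 \in K /\
  (forall A B : {set V}, A \subset B -> B \in K -> A \in K).

Definition balanced (m k : nat) (K : {set {set 'I_m}}) : Prop :=
  (forall A : {set 'I_m}, (#|A| <= k)%N -> A \in K) /\
  (forall A : {set 'I_m}, A \in K -> (#|A| <= k.+1)%N).

Definition collectively_unavoidable (m r : nat)
    (K : 'I_r -> {set {set 'I_m}}) : Prop :=
  forall A : 'I_r -> {set 'I_m},
    (forall i j : 'I_r, i != j -> [disjoint A i & A j]) ->
    exists i : 'I_r, A i \in K i.

(* The disjoint union of r copies of [m] is 'I_r * 'I_m; a simplex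
   A_1 |_| ... |_| A_r of the join is the set S of the (i, v) with v in A_i. *)
Definition join_part (m r : nat) (S : {set 'I_r * 'I_m}) (i : 'I_r) :
    {set 'I_m} :=
  [set v : 'I_m | (i, v) \in S]%SET.

Definition deleted_join (m r : nat) (K : 'I_r -> {set {set 'I_m}}) :
    {set {set 'I_r * 'I_m}} :=
  [set S : {set 'I_r * 'I_m} |
    [forall i, forall j,
       (i != j) ==> [disjoint join_part S i & join_part S j]] &&
    [forall i, join_part S i \in K i]]%SET.

Definition symm_del_join (m r : nat) (K : 'I_r -> {set {set 'I_m}}) :
    {set {set 'I_r * 'I_m}} :=
  (\bigcup_(s : 'S_r) deleted_join (fun i => K (s i)))%SET.

Local Open Scope classical_set_scope.

(* Barycentric coordinates.  As V is finite, the topology of the realization is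
   the one induced by the product topology of R^V. *)
Definition realization (R : realType) (V : finType) (K : {set {set V}}) :
    set {ptws V -> R} :=
  [set x : {ptws V -> R} |
    [/\ forall v : V, 0 <= x v,
        \sum_(v : V) x v = 1 &
        [set v : V | x v != 0]%SET \in K]].

Arguments realization R {V} K.

(* The library norm on 'rV[R]_d is the sup norm, hence the explicit sums of
   squares: these are S^(d-1) and D^d. *)
Definition unit_sphere (R : realType) (d : nat) : set 'rV[R]_d :=
  [set x : 'rV[R]_d | \sum_(i < d) x ord0 i ^+ 2 = 1].

Definition unit_disk (R : realType) (d : nat) : set 'rV[R]_d :=
  [set x : 'rV[R]_d | \sum_(i < d) x ord0 i ^+ 2 <= 1].

Arguments unit_sphere R d : clear implicits.
Arguments unit_disk R d : clear implicits.

(* For n <= -2 both clauses are void. *)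
Definition n_connected (R : realType) (T : topologicalType) (n : int)
    (X : set T) : Prop :=
  (- 1 <= n -> X !=set0) /\
  forall j : nat, j%:Z <= n ->
  forall f : 'rV[R]_j.+1 -> T,
    {within unit_sphere R j.+1, continuous f} ->
    f @` unit_sphere R j.+1 `<=` X ->
  exists g : 'rV[R]_j.+1 -> T,
    [/\ {within unit_disk R j.+1, continuous g},
        g @` unit_disk R j.+1 `<=` X &
        forall x : 'rV[R]_j.+1, unit_sphere R j.+1 x -> g x = f x].

Arguments n_connected R {T} n X.

Definition complex_n_connected (R : realType) (V : finType) (n : int)
    (K : {set {set V}}) : Prop :=
  n_connected R n (realization R K).

Arguments complex_n_connected R {V} n K.

(* Main.v *)
From HB Require Import structures.
Require Import Defs.
From mathcomp Require Import all_boot all_order all_algebra all_fingroup.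
From mathcomp Require Import all_classical all_reals all_analysis.
From mathcomp Require Import zify ring lra.
Import Order.TTheory GRing.Theory Num.Theory.
Import numFieldNormedType.Exports.

(** The proof is a discrete Morse argument.  Write [A_i] for the vertices of colour
    [i] in a face.  All faces with at most [m - r] vertices, the empty one included,
    are matched in pairs differing by one vertex, and the matching is acyclic.  The
    complex is therefore built from a point by elementary expansions and by
    attaching simplices with more than [m - r] vertices, and neither step creates
    an essential sphere of dimension less than [m - r].

    The matching.  Let [a_1] be the first vertex with colour [1] or without colour,
    and let [a_(i+1)] be the first vertex beyond [a_i] with colour [i+1] or without
    colour.  They exist when at least [r] vertices have no colour.  Giving or taking
    away the colour [i] of one [a_i] changes none of them, hence none of the caps
    [C_i], which are the sets [A_i] with [a_i] added.  Among the colours let [c] be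
    one whose cap lies in the largest number of the complexes [K_s]; this choice
    depends on the caps only, so putting [a_c] in or out of the face is an
    involution.  What has to be checked is that adding [a_c] yields a face again:
    by [exists_popular_cap] unavoidability provides a cap which lies in more
    complexes than are taken by the parts with [k + 1] elements, and such a cap can
    be accommodated by permuting the complexes ([toggle_pivot_face]).  The matching
    is acyclic because the sequence of the [a_i] grows lexicographically with the
    face ([rank_of_mono], [rank_of_strict]).

    The topology.  Spheres are moved by homotopies along segments inside simplices
    ([null_in_homotopy]).  Across an elementary collapse there is an explicit
    retraction ([spheres_null_collapse]).  A sphere of dimension [j] is moved off a
    facet with more than [j + 1] vertices by pushing it into the [j]-skeleton
    ([skeletal_approximation]): a partition of unity subordinate to the
    stars of a triangulated cube boundary, at most [j + 1] members of which are
    nonzero at each point, replaces simplicial approximation.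
    [spheres_null_of_matching] combines these. *)

Set Implicit Arguments.
Unset Strict Implicit.
Unset Printing Implicit Defensive.

Local Open Scope nat_scope.

(** * Choosing distinct representatives *)

(** A greedy choice suffices: when the values on [A] and on some elements
    of [D] are fixed, fewer than [#|A| + #|D|] values are taken, so one is left
    in each remaining [S i]. *)
Lemma injective_on_extension (I U : finType) (A D : {set I}) (f : I -> U)
    (S : I -> {set U}) :
    {in A &, injective f} -> [disjoint A & D] ->
    (forall i, i \in D -> #|A| + #|D| <= #|S i|) ->
  exists g : I -> U, [/\ {in A, g =1 f}, {in A :|: D &, injective g} &
                         forall i, i \in D -> g i \in S i].
Proof.
move=> f_inj; move En: #|D| => n.
elim: n D En => [|n IH] D cardD disAD largeS.
  have -> : D = finset.set0 by apply/eqP; rewrite -cards_eq0 cardD.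
  by exists f; split=> [||i]; rewrite ?finset.setU0 ?inE.
have /card_gt0P [d dD] : 0 < #|D| by rewrite cardD.
have dA : d \notin A by rewrite (disjointFl disAD dD).
have cardDd : #|D :\ d| = n by move: cardD; rewrite (cardsD1 d) dD => -[].
have [||g [gf g_inj gS]] := IH _ cardDd.
- by apply: disjointWr disAD; exact: subsetDl.
- move=> i /setD1P [_ iD]; apply: leq_trans (largeS _ iD).
  by rewrite addnS.
have /card_gt0P [u] : 0 < #|S d :\: g @: (A :|: (D :\ d))|.
  rewrite cardsD subn_gt0; apply: leq_trans (largeS _ dD).
  apply: leq_ltn_trans (subset_leq_card (subsetIr _ _)) _.
  apply: leq_ltn_trans (leq_imset_card _ _) _.
  rewrite addnS ltnS -cardDd cardsU; exact: leq_subr.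
rewrite inE => /andP[uN uS].
exists (fun i => if i == d then u else g i); split.
- move=> i iA; case: eqP => [eid|_]; last exact: gf.
  by move: dA; rewrite -eid iA.
- have dec i : i \in A :|: D -> i != d -> i \in A :|: (D :\ d).
    by rewrite !inE => /orP[->//|->] -> ; rewrite orbT.
  move=> i j iAD jAD; case: (eqVneq i d) => [->|nid];
    case: (eqVneq j d) => [->|njd] //.
  + by move=> eu; move: uN; rewrite eu imset_f // dec.
  + by move=> eu; move: uN; rewrite -eu imset_f // dec.
  + by apply: g_inj; exact: dec.
- move=> i iD; case: (eqVneq i d) => [->//|nid].
  by apply: gS; rewrite !inE nid.
Qed.

Lemma injective_on_perm (I : finType) (A : {set I}) (f : I -> I) :
  {in A &, injective f} -> exists s : {perm I}, {in A, s =1 f}.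
Proof.
move=> f_inj.
have [||g [gf g_inj _]] := @injective_on_extension I I A (~: A) f (fun=> finset.setT) f_inj.
- by rewrite -finset.setI_eq0 finset.setICr.
- by move=> i _; rewrite cardsT cardsC.
have ginj : injective g by move=> i j; apply: g_inj; rewrite finset.setUCr inE.
by exists (perm ginj) => i iA; rewrite permE gf.
Qed.

(** * Increasing sequences of first available positions *)

Section Chain.

Variable m : nat.

(** The value [m] stands for the absence of a position below [m] satisfying
    [p]. *)
Definition first_below (p : pred nat) : nat := find p (iota 0 m).

Lemma first_below_le p : first_below p <= m.
Proof. by rewrite -[leqRHS](size_iota 0 m) find_size. Qed.

Lemma first_below_lt (p : pred nat) : first_below p < m -> p (first_below p).
Proof.
move=> lt_m; rewrite -[X in p X](add0n (first_below p)) -(nth_iota 0 0 lt_m).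
by apply: nth_find; rewrite has_find size_iota.
Qed.

Lemma first_below_min (p : pred nat) v : v < m -> p v -> first_below p <= v.
Proof.
move=> vm pv; rewrite leqNgt; apply/negP => /(before_find 0).
by rewrite nth_iota ?add0n ?pv.
Qed.

Lemma first_below_sub (p q : pred nat) :
  (forall v, v < m -> q v -> p v) -> first_below p <= first_below q.
Proof.
move=> sub; have := first_below_le q; rewrite leq_eqVlt => /predU1P [->|lt].
  exact: first_below_le.
by apply: first_below_min => //; apply: sub => //; exact: first_below_lt.
Qed.

Variable I : eqType.
Implicit Types (P Q : I -> pred nat) (l : seq I) (x : nat).

(** Scanning strictly upwards from the previous entry makes the entries
    independent of the availability of smaller positions.  A missing position is
    recorded as [m], and then so are all later ones. *)
Fixpoint chain P x l : seq nat :=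
  if l is i :: l' then
    let y := first_below (fun v => (x <= v) && P i v) in y :: chain P y.+1 l'
  else [::].

Lemma size_chain P x l : size (chain P x l) = size l.
Proof. by elim: l x => //= i l IH x; rewrite IH. Qed.

(** Fewer available positions push the first position that changes upwards;
    what happens after that one is irrelevant lexicographically. *)
Lemma chain_lexi P Q x l : (forall i v, Q i v -> P i v) ->
  ((chain P x l : seqlexi nat) <= (chain Q x l : seqlexi nat))%O.
Proof.
move=> QP; elim: l x => //= i l IH x; rewrite lexi_cons !leEnat.
rewrite first_below_sub /=; last by move=> v _ /andP[-> /QP].
apply/implyP => le; rewrite (_ : first_below _ = first_below (fun v => (x <= v) && Q i v)) //.
by apply/eqP; rewrite eqn_leq le andbT first_below_sub // => v _ /andP[-> /QP].
Qed.

Lemma chain_ge P x l y : y \in chain P x l -> y < m -> x <= y.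
Proof.
elim: l x => //= i l IH x; rewrite inE => /predU1P[->|yin] ym.
  by have /andP[] := first_below_lt ym.
have lt_y := IH _ yin ym.
have /andP[xz _] := first_below_lt (ltn_trans lt_y ym).
exact: leq_trans xz (ltnW lt_y).
Qed.

Definition chain_at P x l i := nth m (chain P x l) (index i l).

Lemma chain_at_mem P x l i : i \in l -> chain_at P x l i \in chain P x l.
Proof. by move=> il; rewrite mem_nth // size_chain index_mem. Qed.

Lemma chain_atP P x l i : chain_at P x l i < m -> P i (chain_at P x l i).
Proof.
rewrite /chain_at; elim: l x => [|j l IH] x /=; first by rewrite ltnn.
case: eqP => [<-|ne] /=; last exact: IH.
by move=> /first_below_lt /andP[].
Qed.

Lemma chain_at_inj P x l i j : i != j -> chain_at P x l i < m ->
  chain_at P x l i != chain_at P x l j.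
Proof.
rewrite /chain_at; elim: l x => [|k l IH] x ne /=; first by rewrite ltnn.
have [eki|neki] := eqVneq k i; have [ekj|nekj] := eqVneq k j => /=.
- by move: ne; rewrite -eki -ekj eqxx.
- move=> lt; apply/negP => /eqP eq.
  case: (boolP (j \in l)) => jl; last first.
    by move: lt; rewrite eq nth_default ?ltnn // size_chain memNindex.
  by have := chain_ge (chain_at_mem P (first_below (fun v => (x <= v) && P k v)).+1 jl);
     rewrite /chain_at -eq lt ltnn => /(_ isT).
- move=> lt; apply/negP => /eqP eq.
  case: (boolP (i \in l)) => il; last first.
    by move: lt; rewrite nth_default ?ltnn // size_chain memNindex.
  have := chain_ge (chain_at_mem P (first_below (fun v => (x <= v) && P k v)).+1 il).
  by rewrite /chain_at lt => /(_ isT); rewrite [X in _ < X]eq ltnn.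
- exact: IH.
Qed.

Lemma eq_chain_above P Q x l y : y < x ->
  (forall j v, v != y -> P j v = Q j v) -> chain P x l = chain Q x l.
Proof.
move=> + PQ; elim: l x => //= j l IH x yx.
have -> : first_below (fun v => (x <= v) && P j v)
        = first_below (fun v => (x <= v) && Q j v).
  apply: eq_find => v; case: leqP => //= xv; apply: PQ.
  by apply: contraTneq xv => ->; rewrite -ltnNge.
congr (_ :: _); have [ym|] := ltnP (first_below (fun v => (x <= v) && Q j v)) m.
  by apply: IH; have /andP[/(leq_trans yx)/leqW] := first_below_lt ym.
move=> my; have -> : first_below (fun v => (x <= v) && Q j v) = m.
  by apply/eqP; rewrite eqn_leq my first_below_le.
have stuck R k z : m <= z -> first_below (fun v => (z <= v) && R k v) = m :> nat.
  move=> mz; apply/eqP; rewrite eqn_leq first_below_le /= leqNgt; apply/negP => lt.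
  by have /andP[+ _] := first_below_lt lt; rewrite leqNgt (leq_trans lt).
have: m <= m.+1 by [].
elim: l {IH} m.+1 => //= k l IH z mz.
by rewrite !(stuck _ _ _ _ mz) (IH _ (leqnSn m)).
Qed.

(** The position [y] given to [i] stays where it is when its availability to
    the others changes: earlier entries stop before [y], later ones look only
    above [y]. *)
Lemma chain_toggle P Q x l i : chain_at P x l i < m ->
    (forall j v, (v != chain_at P x l i) || (j == i) -> P j v = Q j v) ->
  chain P x l = chain Q x l.
Proof.
rewrite /chain_at; elim: l x => [|k l IH] x //=.
case: (eqVneq k i) => [->|ne] /= lt PQ.
  set z := first_below _ in lt PQ *.
  have <- : z = first_below (fun v => (x <= v) && Q i v).
    by apply: eq_find => v; rewrite PQ // eqxx orbT.
  congr (_ :: _); apply: (@eq_chain_above _ _ _ _ z) => // j v nv.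
  by rewrite PQ ?nv.
set y := nth _ _ _ in lt PQ.
have il : i \in l.
  by apply: contraTT lt => il; rewrite -leqNgt /y nth_default // size_chain memNindex.
set z := first_below (fun v => (x <= v) && P k v) in y lt PQ *.
have zy : z < y by exact: (chain_ge (chain_at_mem P z.+1 il)).
have zm := ltn_trans zy lt.
have ez : first_below (fun v => (x <= v) && Q k v) = z.
  have /andP[xz Pz] := first_below_lt zm.
  apply/eqP; rewrite eqn_leq first_below_min //=; last first.
    by rewrite xz -PQ // neq_ltn zy.
  set w := first_below _; rewrite leqNgt; apply/negP => wz.
  have wm : w < m by exact: ltn_trans zm.
  have /andP[xw Qw] := first_below_lt wm.
  have: z <= w by apply: first_below_min => //; rewrite xw PQ // neq_ltn (ltn_trans wz zy).
  by rewrite leqNgt wz.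
by rewrite ez; congr (_ :: _); exact: IH.
Qed.

(** Each entry is at most the first element of [B] beyond the previous one, so
    one element of [B] is used up at most at each step. *)
Lemma chain_defined P x l (B : {set 'I_m}) :
    (forall i (v : 'I_m), v \in B -> P i v) ->
    size l <= #|[set v in B | x <= v]| ->
  all (ltn^~ m) (chain P x l).
Proof.
move=> BP; elim: l x => //= i l IH x sl.
set y := first_below _.
have bnd (v : 'I_m) : v \in B -> x <= v -> y <= v.
  by move=> vB xv; apply: first_below_min => //; rewrite xv BP.
have /card_gt0P [b] : 0 < #|[set v in B | x <= v]| by exact: leq_ltn_trans sl.
rewrite !inE => /andP[bB xb].
have ym : y < m by exact: leq_ltn_trans (bnd _ bB xb) (ltn_ord b).
have /andP[xy _] := first_below_lt ym.
rewrite ym /= IH //.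
have : [set v in B | x <= v] \subset Ordinal ym |: [set v in B | y < v].
  apply/fintype.subsetP => v; rewrite !inE => /andP[vB xv].
  by rewrite vB /= -val_eqE /= eq_sym -leq_eqVlt bnd.
move=> /subset_leq_card /(leq_trans sl); rewrite cardsU1.
by case: (_ \notin _); rewrite ?add1n ?add0n // => /ltnW.
Qed.

End Chain.

(** * Adding or removing one vertex *)

Definition toggle (V : finType) (S : {set V}) (p : V) : {set V} :=
  if p \in S then S :\ p else p |: S.

Lemma in_toggle (V : finType) (S : {set V}) p q :
  (q \in toggle S p) = (q \in S) (+) (q == p).
Proof.
rewrite /toggle; case: ifP => pS; rewrite !inE; case: eqP => [->|];
  by rewrite ?pS //= ?addbF.
Qed.

Lemma toggleK (V : finType) (S : {set V}) p : toggle (toggle S p) p = S.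
Proof. by apply/setP => q; rewrite !in_toggle -addbA addbb addbF. Qed.

(** * The matching on the symmetrized deleted join *)

Lemma pair3_inj (A B C : Type) (a a' : A) (b b' : B) (c c' : C) :
  (a, (b, c)) = (a', (b', c')) -> [/\ a = a', b = b' & c = c'].
Proof. by case. Qed.

Lemma subset_card_eq (T : finType) (A B : {set T}) :
  A \subset B -> #|A| = #|B| -> A = B.
Proof. by move=> AB e; apply/eqP; rewrite eqEcard AB e leqnn. Qed.

Definition available (m r : nat) (S : {set 'I_r * 'I_m}) (i : 'I_r) (v : nat) : bool :=
  [forall p : 'I_r * 'I_m, (p \in S) ==> (p.2 == v :> nat) ==> (p.1 == i)].

HB.lock Definition apexes (m r : nat) (S : {set 'I_r * 'I_m}) : seq nat :=
  chain m (available S) 0 (enum 'I_r).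

Definition apex (m r : nat) (S : {set 'I_r * 'I_m}) (i : 'I_r) : nat :=
  nth m (apexes S) (index i (enum 'I_r)).

Definition apex_vertices (m r : nat) (S : {set 'I_r * 'I_m}) : {set 'I_r * 'I_m} :=
  [set p : 'I_r * 'I_m | p.2 == apex S p.1 :> nat].

(** The cap [C_i]: the colour [i] is given to [a_i], whether or not it has it
    already. *)
Definition capped_part (m r : nat) (S : {set 'I_r * 'I_m}) (i : 'I_r) : {set 'I_m} :=
  join_part (S :|: apex_vertices S) i.

Definition owners (m r : nat) (K : 'I_r -> {set {set 'I_m}}) (C : {set 'I_m}) :
  {set 'I_r} := [set s | C \in K s].

(** A cap that lies in many complexes is the easiest one to accommodate.  The
    default [i0] only witnesses that colours exist. *)
HB.lock Definition chosen (m r : nat) (i0 : 'I_r) (K : 'I_r -> {set {set 'I_m}})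
    (S : {set 'I_r * 'I_m}) : 'I_r :=
  [arg max_(i > i0) #|owners K (capped_part S i)|].

Section Matching.

Variables (m r : nat) (i0 : 'I_r) (v0 : 'I_m) (K : 'I_r -> {set {set 'I_m}}).
Implicit Types S T : {set 'I_r * 'I_m}.

Notation chosen := (chosen i0 K).

Definition pivot S : 'I_r * 'I_m := (chosen S, insubd v0 (apex S (chosen S))).

Definition base S := S :\: apex_vertices S.

Definition other_apexes S : {set 'I_r * 'I_m} :=
  [set p in S :&: apex_vertices S | p.1 != chosen S].

Lemma in_other_apexes S p : (p \in other_apexes S) =
  [&& p \in S, p \in apex_vertices S & p.1 != chosen S].
Proof. by rewrite finset.in_set finset.in_setI andbA. Qed.

(** Along an inclusion of faces the apexes can only grow lexicographically;
    for equal apexes the part of the face without apexes can only grow; for equal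
    such parts the chosen colour is the same, and the other apexes that are in use
    can only become more numerous.  What is left free is the pivot alone, so the
    faces of equal rank that are comparable form matched pairs. *)
Definition rank_of S : seqlexi nat *l (nat *l nat) :=
  (apexes S, (#|base S|, #|other_apexes S|)).

Lemma apexE S i : apex S i = chain_at m (available S) 0 (enum 'I_r) i.
Proof. by rewrite /apex apexes.unlock. Qed.

Lemma availableP S (i : 'I_r) (v : 'I_m) :
  reflect (forall j, (j, v) \in S -> j = i) (available S i v).
Proof.
apply: (iffP forallP) => [H j jS|H [j w]]; first by have := H (j, v); rewrite jS eqxx => /eqP.
by apply/implyP => /= jS; apply/implyP => /eqP/val_inj ew; apply/eqP/H; rewrite -ew.
Qed.

Lemma available_sub S T : S \subset T -> forall i v, available T i v -> available S i v.
Proof.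
move=> /fintype.subsetP ST i v /forallP H; apply/forallP => p.
by apply/implyP => /ST pT; move: (H p); rewrite pT.
Qed.

Lemma apex_eq S T : apexes S = apexes T -> apex S =1 apex T.
Proof. by move=> e i; rewrite /apex e. Qed.

Lemma apex_vertices_eq S T : apexes S = apexes T -> apex_vertices S = apex_vertices T.
Proof.
by move=> e; apply/setP => p; rewrite !inE (apex_eq e).
Qed.

(** Whether the apexes are used by the face is what the capped parts forget, so
    the chosen colour and the pivot depend on the apexes and the rest only. *)
Lemma capped_part_eq S T : apexes S = apexes T ->
  base S = base T -> capped_part S = capped_part T.
Proof.
move=> ea; have ev := apex_vertices_eq ea; rewrite /base -ev => eb.
rewrite /capped_part -ev; apply: funext => i; apply/setP => v; rewrite !inE.
move/setP: eb => /(_ (i, v)); rewrite !inE.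
by case: (_ == _) => /=; rewrite ?orbT ?orbF.
Qed.

Lemma chosen_eq S T : apexes S = apexes T ->
  base S = base T -> chosen S = chosen T.
Proof. by move=> ea eb; rewrite chosen.unlock (capped_part_eq ea eb). Qed.

Lemma pivot_eq S T : apexes S = apexes T ->
  base S = base T -> pivot S = pivot T.
Proof.
by move=> ea eb; rewrite /pivot (chosen_eq ea eb) (apex_eq ea).
Qed.

Lemma base_sub S T : S \subset T -> apexes S = apexes T -> base S \subset base T.
Proof. by move=> ST ea; rewrite /base (apex_vertices_eq ea); exact: finset.setSD. Qed.

Lemma other_apexes_sub S T : S \subset T -> apexes S = apexes T ->
  base S = base T -> other_apexes S \subset other_apexes T.
Proof.
move=> ST ea eb; apply/fintype.subsetP => p.
rewrite (in_other_apexes S p) (in_other_apexes T p) (chosen_eq ea eb) (apex_vertices_eq ea).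
by case/and3P => /(fintype.subsetP ST) -> -> ->.
Qed.

Lemma rank_of_mono S T : S \subset T -> (rank_of S <= rank_of T)%O.
Proof.
move=> ST; have leap : ((apexes S : seqlexi nat) <= apexes T)%O.
  by rewrite apexes.unlock; apply: chain_lexi => i v; exact: available_sub.
rewrite lexi_pair leap /=; apply/implyP => geap.
have ea : apexes S = apexes T :> seqlexi nat by apply/eqP; rewrite eq_le leap geap.
have sub := base_sub ST ea.
rewrite lexi_pair !leEnat (subset_leq_card sub) /=; apply/implyP => ge.
have eb : base S = base T by apply/eqP; rewrite eqEcard sub ge.
exact: subset_leq_card (other_apexes_sub ST ea eb).
Qed.

Lemma rank_of_strict S T : S \subset T -> S != T -> rank_of S = rank_of T ->
  T = pivot S |: S.
Proof.
move=> ST neST e; have [ea cb ct] := pair3_inj e.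
have eb := subset_card_eq (base_sub ST ea) cb.
have et := subset_card_eq (other_apexes_sub ST ea eb) ct.
have new p : p \in T -> p \notin S -> p = pivot S.
  move=> pT pS; move/setP: eb (chosen_eq ea eb) => /(_ p) + ec.
  rewrite !finset.in_setD pT (negbTE pS).
  rewrite andbF andbT -(apex_vertices_eq ea) => /esym/negbFE pa.
  have := in_other_apexes T p; rewrite -et (in_other_apexes S p) pT (negbTE pS).
  rewrite -(apex_vertices_eq ea) pa /= -ec => /esym/negbFE/eqP pc.
  move: pa; rewrite inE; case: p pc {pT pS} => i v /= -> /eqP va.
  by rewrite /pivot -va valKd.
have [p pT pS] : exists2 p, p \in T & p \notin S.
  by apply/subsetPn; apply: contraNN neST => TS; rewrite finset.eqEsubset ST.
apply/setP => q; rewrite !inE -(new p pT pS).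
apply/idP/orP => [qT|[/eqP->//|/(fintype.subsetP ST)//]].
have [qS|qS] := boolP (q \in S); first by right.
by left; rewrite (new q qT qS) (new p pT pS).
Qed.

Definition uncoloured S : {set 'I_m} := [set v | [forall i, (i, v) \notin S]].

Lemma card_uncoloured S : m <= #|S| + #|uncoloured S|.
Proof.
rewrite -[X in X <= _]card_ord -cardsT.
rewrite (_ : finset.setT = (snd @: S) :|: uncoloured S).
  rewrite cardsU; apply: leq_trans (leq_subr _ _) _.
  by rewrite leq_add2r leq_imset_card.
apply/esym/setP => v; rewrite !inE; apply/orP.
have [/existsP[i iS]|] := boolP [exists i, (i, v) \in S].
  by left; apply/imsetP; exists (i, v).
by rewrite negb_exists; right.
Qed.

(** A face with at most [m - r] vertices leaves [r] vertices uncoloured, and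
    these are available to every colour. *)
Lemma apex_lt S i : #|S| + r <= m -> apex S i < m.
Proof.
move=> le; suff /allP : all (ltn^~ m) (apexes S).
  by rewrite apexE; apply; rewrite apexes.unlock chain_at_mem // mem_enum.
rewrite apexes.unlock.
apply: (@chain_defined _ _ _ _ _ (uncoloured S)) => [j v|].
  by rewrite inE => /forallP nv; apply/availableP => k; rewrite (negbTE (nv k)).
rewrite size_enum_ord (_ : [set _ in _ | _] = uncoloured S); last first.
  by apply/setP => v; rewrite !inE andbT.
by rewrite -(leq_add2l #|S|) (leq_trans le) // card_uncoloured.
Qed.

Lemma pivot_val S : #|S| + r <= m -> (pivot S).2 = apex S (chosen S) :> nat.
Proof. by move=> le; rewrite /= val_insubd apex_lt. Qed.

Section TogglePivot.

Variable S : {set 'I_r * 'I_m}.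
Hypothesis leS : #|S| + r <= m.
Let T := toggle S (pivot S).

(** The pivot is the apex of its own colour, hence remains available to that
    colour, and its availability to other colours does not affect the apexes. *)
Lemma apexes_toggle : apexes T = apexes S.
Proof.
rewrite apexes.unlock; apply/esym; apply: (@chain_toggle _ _ _ _ _ _ (chosen S)).
  by rewrite -apexE apex_lt.
move=> j v; rewrite -apexE -(pivot_val leS) => H.
apply: eq_forallb => q; rewrite in_toggle.
case: (eqVneq q (pivot S)) => [->|]; rewrite ?addbF //.
case/orP: H => [nv|/eqP->]; last by rewrite eqxx !implybT.
by rewrite eq_sym (negbTE nv) /= !implybT.
Qed.

Lemma pivot_apex_vertex : pivot S \in apex_vertices S.
Proof. by rewrite inE pivot_val //= eqxx. Qed.

Lemma base_toggle : base T = base S.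
Proof.
rewrite /base (apex_vertices_eq apexes_toggle); apply/setP => q; rewrite !inE in_toggle.
case: (eqVneq q (pivot S)) => [->|]; rewrite ?addbF //.
by move: pivot_apex_vertex; rewrite inE => ->.
Qed.

Lemma pivot_toggle : pivot T = pivot S.
Proof. exact: pivot_eq apexes_toggle base_toggle. Qed.

Lemma rank_of_toggle : rank_of T = rank_of S.
Proof.
rewrite /rank_of base_toggle apexes_toggle.
congr (_, (_, _)).
apply: eq_card => q; rewrite (in_other_apexes T q) (in_other_apexes S q).
rewrite (chosen_eq apexes_toggle base_toggle) (apex_vertices_eq apexes_toggle) in_toggle.
case: (eqVneq q (pivot S)) => [->|]; rewrite ?addbF //.
by rewrite eqxx !andbF.
Qed.

End TogglePivot.

Hypothesis K_complex : forall i, simplicial_complex (K i).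
Hypothesis K_unavoidable : collectively_unavoidable K.
Variable k : nat.
Hypothesis K_balanced : forall i, balanced k (K i).

Lemma deleted_joinP (L : 'I_r -> {set {set 'I_m}}) S :
  reflect ((forall i j v, (i, v) \in S -> (j, v) \in S -> i = j) /\
           (forall i, join_part S i \in L i)) (S \in deleted_join L).
Proof.
rewrite inE; apply: (iffP andP) => -[disj mem]; split; try by apply/forallP.
- move=> i j v iS jS; apply/eqP; apply: contraT => ne.
  move/forallP: disj => /(_ i)/forallP/(_ j)/implyP/(_ ne).
  by rewrite -setI_eq0 => /eqP/setP/(_ v); rewrite !inE iS jS.
- apply/forallP => i; apply/forallP => j; apply/implyP => ne.
  rewrite -setI_eq0; apply/eqP/setP => v; rewrite !inE.
  by apply: contraNF ne => /andP[iS jS]; rewrite (disj i j v).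
Qed.

Lemma symm_del_joinP S :
  reflect ((forall i j v, (i, v) \in S -> (j, v) \in S -> i = j) /\
           exists s : 'S_r, forall i, join_part S i \in K (s i))
          (S \in symm_del_join K).
Proof.
apply: (iffP bigcupP) => [[s _ /deleted_joinP[disj mem]]|[disj [s mem]]].
  by split=> //; exists s.
by exists s => //; apply/deleted_joinP.
Qed.

Lemma symm_del_join_complex : simplicial_complex (symm_del_join K).
Proof.
split=> [|S T /fintype.subsetP ST /symm_del_joinP[disj [s mem]]].
  apply/symm_del_joinP; split=> [i j v|]; rewrite ?inE //.
  exists 1%g => i; rewrite (_ : join_part _ _ = finset.set0).
    by case: (K_complex ((1 : 'S_r)%g i)).
  by apply/setP => v; rewrite !inE.
apply/symm_del_joinP; split=> [i j v /ST iT /ST jT|]; first exact: disj iT jT.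
exists s => i; case: (K_complex (s i)) => _; apply; last exact: mem.
by apply/fintype.subsetP => v; rewrite !inE => /ST.
Qed.

(** A part with at most [k] elements lies in every complex, so these are the
    only colours that constrain the permutation witnessing that [S] is a face. *)
Definition large_parts S : {set 'I_r} := [set i | k < #|join_part S i|].

Section Face.

Variable S : {set 'I_r * 'I_m}.
Hypotheses (S_face : S \in symm_del_join K) (leS : #|S| + r <= m).

Let v i : 'I_m := insubd v0 (apex S i).
Let val_v i : v i = apex S i :> nat.
Proof. by rewrite val_insubd apex_lt. Qed.

Let v_avail i j : (j, v i) \in S -> j = i.
Proof.
have : available S i (v i) by rewrite val_v apexE; apply: chain_atP; rewrite -apexE apex_lt.
by move/availableP; apply.
Qed.

Lemma capped_partE i : capped_part S i = v i |: join_part S i.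
Proof. by apply/setP => w; rewrite !inE -val_v orbC. Qed.

(** Here unavoidability enters.  Let [T] be the set of large parts.  If every
    cap outside [T] had at most [#|T|] owners, each of the [r - #|T|] colours
    outside [T] could be given a complex that does not contain its cap, all
    different, by a greedy choice.  The parts in [T], enlarged by one uncoloured
    vertex each, have [k + 2] elements and lie in no complex at all.  There are
    enough uncoloured vertices to keep all these sets disjoint, and together they
    avoid every complex, for a suitable numbering of the complexes. *)
Lemma exists_popular_cap :
  exists2 i, i \notin large_parts S & #|large_parts S| < #|owners K (capped_part S i)|.
Proof.
have /symm_del_joinP[disj [s0 mem]] := S_face.
have [/existsP[i /andP[iT lt]]|] :=
  boolP [exists i, (i \notin large_parts S) && (#|large_parts S| < #|owners K (capped_part S i)|)].
  by exists i.
rewrite negb_exists => /forallP none; exfalso.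
set T := large_parts S in none *.
have few i : i \notin T -> #|owners K (capped_part S i)| <= #|T|.
  by move=> iT; have := none i; rewrite iT /= -leqNgt.
have ltTr i : i \notin T -> #|T| < r.
  move=> iT; rewrite -[X in _ < X]card_ord -cardsT; apply: proper_card.
  by rewrite properT; apply: contraNneq iT => ->; rewrite finset.inE.
(* An apex already used by a small part would make the cap small, hence owned by all. *)
have v_free i : i \notin T -> v i \in uncoloured S.
  move=> iT; rewrite inE; apply/forallP => j; apply/negP => jS.
  have eji := v_avail jS; rewrite eji in jS.
  suff : #|owners K (capped_part S i)| = r.
    by move=> e; have := few i iT; rewrite e leqNgt (ltTr i iT).
  rewrite -[RHS]card_ord -cardsT; apply: eq_card => s; rewrite !inE.
  have [small _] := K_balanced s; apply: small.
  rewrite capped_partE (finset.setUidPr _) ?finset.sub1set ?inE //.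
  by move: iT; rewrite inE -leqNgt.
have v_inj : {in ~: T &, injective v}.
  move=> i j _ _ /(congr1 val) /=; rewrite !val_v => e; apply/eqP/contraT => ne.
  have := @chain_at_inj m _ (available S) 0 (enum 'I_r) _ _ ne.
  by rewrite -!apexE apex_lt // e eqxx => /(_ isT).
(* The bad assignment of complexes outside [T], extended to a permutation [s]. *)
have [|||f [_ f_inj f_bad]] := @injective_on_extension 'I_r 'I_r finset.set0 (~: T) id
    (fun i => ~: owners K (capped_part S i)).
- by move=> i j; rewrite inE.
- by rewrite -finset.setI_eq0 finset.set0I.
- move=> i; rewrite inE => iT; rewrite cards0 add0n.
  rewrite cardsCs finset.setCK [leqRHS]cardsCs finset.setCK leq_sub2l //; exact: few.
rewrite finset.set0U in f_inj.
have [s sf] := injective_on_perm f_inj.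
(* The vertices to add: the apexes outside [T], further uncoloured vertices on [T]. *)
have [||e [ev e_inj e_free]] := @injective_on_extension _ _ (~: T) T v
    (fun=> uncoloured S) v_inj.
- by rewrite -finset.setI_eq0 finset.setIC finset.setICr.
- move=> i _; rewrite addnC cardsC card_ord -(leq_add2l #|S|) (leq_trans leS) //.
  exact: card_uncoloured.
have e_unc i : e i \in uncoloured S.
  by have [/e_free//|iT] := boolP (i \in T); rewrite ev ?finset.in_setC // v_free.
have e_part i j : e i \notin join_part S j.
  by rewrite inE; move: (e_unc i); rewrite inE => /forallP.
have [|t] := K_unavoidable (A := fun t => e ((s^-1)%g t) |: join_part S ((s^-1)%g t)).
  move=> i j ne; have {}ne : (s^-1)%g i != (s^-1)%g j by rewrite (inj_eq perm_inj).
  rewrite -finset.setI_eq0; apply/eqP/setP => w; rewrite !inE.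
  apply/negbTE/negP => /andP[/orP[/eqP->|wi] /orP[|wj]].
  - move=> /eqP ee; move/eqP: ne; apply; apply: e_inj ee; rewrite inE inE;
      exact: orNb.
  - by have := e_part ((s^-1)%g i) ((s^-1)%g j); rewrite inE wj.
  - by move=> /eqP ee; have := e_part ((s^-1)%g j) ((s^-1)%g i); rewrite -ee inE wi.
  - by move/eqP: ne; apply; exact: disj wi wj.
set i := (s^-1)%g t; have -> : t = s i by rewrite permKV.
move=> inK; have [iT|iT] := boolP (i \in T).
  have [_ bnd] := K_balanced (s i); move/bnd: inK.
  by rewrite cardsU1 e_part add1n ltnS leqNgt; move: iT; rewrite inE => ->.
have iTc : i \in ~: T by rewrite finset.in_setC.
have := f_bad i iTc; rewrite -(sf i iTc) finset.in_setC finset.in_set.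
by rewrite capped_partE -(ev i iTc) inK.
Qed.

(** When the pivot is to be added, its cap has more owners than there are large
    parts; so an owner is left over by the complexes assigned to the large parts,
    and it can be assigned to the cap. *)
Lemma toggle_pivot_face : toggle S (pivot S) \in symm_del_join K.
Proof.
have /symm_del_joinP[disj [s mem]] := S_face.
rewrite /toggle; case: ifPn => [_|pS].
  have [_ down] := symm_del_join_complex.
  by apply: down S_face; exact: subsetDl.
set c := chosen S.
have pE : pivot S = (c, v c) by [].
rewrite pE in pS *.
have cT : #|large_parts S| < #|owners K (capped_part S c)|.
  have [i iT lt] := exists_popular_cap; apply: leq_trans lt _.
  by rewrite /c chosen.unlock; case: arg_maxnP => // j _; apply.
(* A set with [k + 2] elements has no owner. *)
have c_small : c \notin large_parts S.
  have /card_gt0P [t] : 0 < #|owners K (capped_part S c)| by exact: leq_ltn_trans cT.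
  rewrite inE; have [_ bnd] := K_balanced t; move/bnd.
  by rewrite capped_partE cardsU1 !inE pS add1n ltnS -leqNgt.
have [||g [gs g_inj gc]] := @injective_on_extension _ _ (large_parts S) [set c] s
    (fun i => owners K (capped_part S i)) (in2W perm_inj).
- by rewrite disjoint_sym disjoints1.
- by move=> i /set1P ->; rewrite cards1 addn1.
have [s' s'g] := injective_on_perm g_inj.
have part i : join_part ((c, v c) |: S) i = if i == c then capped_part S c else join_part S i.
  apply/setP => w; rewrite !inE xpair_eqE; case: eqP => [->|_] /=; last by rewrite inE.
  by rewrite capped_partE !inE.
apply/symm_del_joinP; split.
  move=> i j w; rewrite !inE !xpair_eqE.
  move=> /orP[/andP[/eqP-> /eqP->]|iS] /orP[/andP[/eqP-> ew]|jS] //.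
  - by rewrite (v_avail jS).
  - by apply: v_avail; rewrite -(eqP ew).
  - exact: disj iS jS.
exists s' => i; rewrite part; case: eqP => [->|nic].
  by rewrite s'g ?inE ?eqxx ?orbT //; have := gc c (set11 c); rewrite inE.
have [iT|iT] := boolP (i \in large_parts S).
  by rewrite s'g ?gs // finset.inE iT.
have [small _] := K_balanced (s' i); apply: small.
by move: iT; rewrite inE -leqNgt.
Qed.

End Face.
End Matching.

Local Open Scope ring_scope.
Local Open Scope classical_set_scope.

(** * Continuity on a subset *)

Section WithinContinuity.

Variables (R : realType) (T : topologicalType) (A : set T).

Lemma within_comp (U W : topologicalType) (B : set U) (h : T -> U) (f : U -> W) :
  {within A, continuous h} -> (forall x, A x -> B (h x)) ->
  {within B, continuous f} -> {within A, continuous (f \o h)}.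
Proof.
move=> /subspace_continuousP ch hAB /subspace_continuousP cf.
apply/subspace_continuousP => x Ax.
apply: cvg_comp (cf _ (hAB _ Ax)) => P /= nP; rewrite /nbhs /=.
have := ch x Ax _ nP; rewrite /nbhs /= /within /=.
by apply: filterS => t ht At; exact: ht At (hAB _ At).
Qed.

Lemma eq_within (W : topologicalType) (f g : T -> W) :
  (forall x, A x -> f x = g x) -> {within A, continuous f} -> {within A, continuous g}.
Proof.
move=> fg; apply: subspace_eq_continuous => x; rewrite inE => Ax; exact: fg.
Qed.

Lemma within_ptws (V : finType) (f : T -> {ptws V -> R}) :
  {within A, continuous f} <-> forall v, {within A, continuous (fun x => f x v : R)}.
Proof.
split=> [/subspace_continuousP cf v|cf]; apply/subspace_continuousP => x Ax.
  apply: (cvg_comp f (fun g : {ptws V -> R} => g v) (cf x Ax)).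
  exact: (@proj_continuous V (fun=> R) v).
apply/cvg_sup => v U [_ [[W oW <-] Wfx] WU].
apply: filterS WU _; have /subspace_continuousP /(_ x Ax) := cf v; apply.
exact: open_nbhs_nbhs.
Qed.

Implicit Types f g : T -> R.

Lemma within_cst (c : R) : {within A, continuous (fun=> c)}.
Proof. by apply: continuous_subspaceT => x; exact: cvg_cst. Qed.

Lemma withinD f g : {within A, continuous f} -> {within A, continuous g} ->
  {within A, continuous (fun x => f x + g x)}.
Proof. by move=> cf cg x; apply: cvgD; [exact: cf|exact: cg]. Qed.

Lemma withinB f g : {within A, continuous f} -> {within A, continuous g} ->
  {within A, continuous (fun x => f x - g x)}.
Proof. by move=> cf cg x; apply: cvgB; [exact: cf|exact: cg]. Qed.

Lemma withinM f g : {within A, continuous f} -> {within A, continuous g} ->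
  {within A, continuous (fun x => f x * g x)}.
Proof. by move=> cf cg x; apply: cvgM; [exact: cf|exact: cg]. Qed.

Lemma withinV f : {within A, continuous f} -> (forall x, A x -> f x != 0) ->
  {within A, continuous (fun x => (f x)^-1)}.
Proof.
move=> /subspace_continuousP cf f0; apply/subspace_continuousP => x Ax.
by apply: cvgV; [exact: f0|exact: cf].
Qed.

Lemma within_sum (I : finType) (P : pred I) (F : I -> T -> R) :
  (forall i, {within A, continuous (F i)}) ->
  {within A, continuous (fun x => \sum_(i | P i) F i x)}.
Proof.
by move=> cF; apply: continuous_big => [x|i _]; [exact: add_continuous|exact: cF].
Qed.

Lemma within_prod (I : finType) (P : pred I) (F : I -> T -> R) :
  (forall i, {within A, continuous (F i)}) ->
  {within A, continuous (fun x => \prod_(i | P i) F i x)}.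
Proof.
by move=> cF; apply: continuous_big => [x|i _]; [exact: mul_continuous|exact: cF].
Qed.

Lemma within_max f g : {within A, continuous f} -> {within A, continuous g} ->
  {within A, continuous (fun x => Num.max (f x) (g x))}.
Proof.
by move=> cf cg x; apply: continuous_max; [exact: cf|exact: cg].
Qed.

Lemma within_min f g : {within A, continuous f} -> {within A, continuous g} ->
  {within A, continuous (fun x => Num.min (f x) (g x))}.
Proof.
by move=> cf cg x; apply: continuous_min; [exact: cf|exact: cg].
Qed.

Lemma within_bigmin (I : finType) (P : pred I) f (F : I -> T -> R) :
  {within A, continuous f} -> (forall i, {within A, continuous (F i)}) ->
  {within A, continuous (fun x => \big[Num.min/f x]_(i | P i) F i x)}.
Proof.
move=> cf cF; elim: (index_enum I) => [|i l IH].
  by apply: (eq_within (f := f)) => // x _; rewrite big_nil.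
case: (boolP (P i)) => Pi.
  apply: (eq_within (f := fun x => Num.min (F i x) (\big[Num.min/f x]_(i <- l | P i) F i x))).
    by move=> x _; rewrite big_cons Pi.
  exact: within_min.
apply: (eq_within (f := fun x => \big[Num.min/f x]_(i <- l | P i) F i x)) => // x _.
by rewrite big_cons (negbTE Pi).
Qed.

End WithinContinuity.

Section RowVectors.

Variables (R : realType) (d : nat).
Implicit Types x : 'rV[R]_d.

Lemma coord_within (A : set 'rV[R]_d) i : {within A, continuous (fun x : 'rV[R]_d => x ord0 i)}.
Proof. by apply: continuous_subspaceT; exact: coord_continuous. Qed.

Lemma row_within (T : topologicalType) (A : set T) (h : T -> 'rV[R]_d) :
  (forall i, {within A, continuous (fun t => h t ord0 i : R)}) -> {within A, continuous h}.
Proof.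
move=> ch; apply/subspace_continuousP => x Ax; apply/cvgrPdist_lt => e e0.
have : \forall t \near within A (nbhs x), forall i, `|h x ord0 i - h t ord0 i| < e.
  apply: filter_forall => i; have /subspace_continuousP /(_ x Ax) := ch i.
  by move/cvgrPdist_lt; apply.
apply: filterS => t ht; rewrite [ltLHS]mx_normrE; apply/bigmax_ltP; split=> // -[i j] _.
by rewrite !mxE (ord1 i) /=; exact: ht.
Qed.

Lemma scale_within (A : set 'rV[R]_d) (c : 'rV[R]_d -> R) :
  {within A, continuous c} -> {within A, continuous (fun x => c x *: x)}.
Proof.
move=> cc; apply: row_within => i; apply: (eq_within (f := fun x : 'rV[R]_d => c x * x ord0 i)).
  by move=> x _; rewrite mxE.
by apply: withinM => //; exact: coord_within.
Qed.

Definition norm2 x : R := Num.sqrt (\sum_i x ord0 i ^+ 2).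

Lemma norm2_within (A : set 'rV[R]_d) : {within A, continuous norm2}.
Proof.
apply: (@within_comp _ _ _ _ setT (fun x : 'rV[R]_d => \sum_i x ord0 i ^+ 2 : R)) => //.
  apply: within_sum => i; apply: (eq_within (f := fun x : 'rV[R]_d => x ord0 i * x ord0 i)) => //.
  by apply: withinM; exact: coord_within.
by apply: continuous_subspaceT; exact: sqrt_continuous.
Qed.

Lemma norm2Z c x : norm2 (c *: x) = `|c| * norm2 x.
Proof.
rewrite /norm2; under eq_bigr do rewrite mxE exprMn.
by rewrite -mulr_sumr sqrtrM ?sqr_ge0 // sqrtr_sqr.
Qed.

Lemma norm2_gt0 x : x != 0 -> 0 < norm2 x.
Proof.
move=> x0; rewrite sqrtr_gt0 lt_def sumr_ge0 ?andbT; last by move=> i _; exact: sqr_ge0.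
apply: contra x0 => /eqP /psumr_eq0P x0; apply/eqP/rowP => i; rewrite mxE.
by apply/eqP; rewrite -sqrf_eq0; apply/eqP/x0 => // j _; exact: sqr_ge0.
Qed.

Lemma unit_sphereE x : unit_sphere R d x <-> norm2 x = 1.
Proof.
rewrite /unit_sphere /= /norm2; split=> [->|e]; first exact: sqrtr1.
by rewrite -[LHS]sqr_sqrtr ?e ?expr1n // sumr_ge0 // => i _; exact: sqr_ge0.
Qed.

Lemma unit_diskE x : unit_disk R d x <-> norm2 x <= 1.
Proof.
have s0 : 0 <= \sum_i x ord0 i ^+ 2 by apply: sumr_ge0 => i _; exact: sqr_ge0.
rewrite /unit_disk /= /norm2; split=> le.
  by rewrite -sqrtr1 ler_sqrt.
by rewrite -[leLHS]sqr_sqrtr // expr_le1 // sqrtr_ge0.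
Qed.

Lemma closed_norm2 (B : set R) : closed B -> closed [set x | B (norm2 x)].
Proof.
move=> cB; apply: preimage_closed => // x _.
apply: continuous_comp; last exact: sqrt_continuous.
apply: continuous_big => [y|i _ y]; first exact: add_continuous.
suff: continuous (fun z : 'rV[R]_d => z ord0 i * z ord0 i : R) by exact.
by move=> z; have c := @coord_continuous R 1 d ord0 i; exact: (cvgM (c z) (c z)).
Qed.

End RowVectors.

(** * Homotopies in a realization *)

Section Realization.

Variables (R : realType) (V : finType).
Implicit Types (K L : {set {set V}}) (x y : {ptws V -> R}).

Definition carrier x : {set V} := [set v | x v != 0]%SET.

Lemma realization_segment K x y (s : R) : simplicial_complex K ->
    realization R K x -> realization R K y -> (carrier x :|: carrier y)%SET \in K ->
    0 <= s <= 1 ->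
  realization R K (fun v => (1 - s) * x v + s * y v).
Proof.
move=> [_ down] [x0 x1 _] [y0 y1 _] xyK /andP[s0 s1]; split.
- by move=> v; rewrite addr_ge0 // mulr_ge0 ?subr_ge0.
- by rewrite big_split /= -!mulr_sumr x1 y1 !mulr1 subrK.
- apply: down xyK; apply/fintype.subsetP => v; rewrite !inE.
  by apply: contraNT; rewrite negb_or !negbK => /andP[/eqP-> /eqP->]; rewrite !mulr0 addr0.
Qed.

Definition null_in (j : nat) K (f : 'rV[R]_j.+1 -> {ptws V -> R}) : Prop :=
  exists g : 'rV[R]_j.+1 -> {ptws V -> R},
    [/\ {within unit_disk R j.+1, continuous g},
        g @` unit_disk R j.+1 `<=` realization R K &
        forall z, unit_sphere R j.+1 z -> g z = f z].

(** Two maps whose values at each point lie in a common simplex are homotopic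
    along segments.  The disk of radius [1/2] carries the extension of [f1], the
    remaining annulus carries the homotopy from [f1] to [f0]. *)
Lemma null_in_homotopy (j : nat) K (f0 f1 : 'rV[R]_j.+1 -> {ptws V -> R}) :
    simplicial_complex K ->
    {within unit_sphere R j.+1, continuous f0} ->
    {within unit_sphere R j.+1, continuous f1} ->
    f0 @` unit_sphere R j.+1 `<=` realization R K ->
    f1 @` unit_sphere R j.+1 `<=` realization R K ->
    (forall z, unit_sphere R j.+1 z -> (carrier (f1 z) :|: carrier (f0 z))%SET \in K) ->
  null_in K f1 -> null_in K f0.
Proof.
move=> Kc c0 c1 f0K f1K f01 [g1 [cg1 g1K g1f]].
pose u (x : 'rV[R]_j.+1) := (norm2 x)^-1 *: x.
pose s (x : 'rV[R]_j.+1) : R := 2 * norm2 x - 1.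
pose h (x : 'rV[R]_j.+1) : {ptws V -> R} := fun v => (1 - s x) * f1 (u x) v + s x * f0 (u x) v.
pose inner := [set x : 'rV[R]_j.+1 | norm2 x <= 1/2].
pose outer := [set x : 'rV[R]_j.+1 | 1/2 <= norm2 x /\ norm2 x <= 1].
have outer_sphere (x : 'rV[R]_j.+1) : outer x -> unit_sphere R j.+1 (u x).
  move=> [x2 _]; have x0 : 0 < norm2 x by lra.
  by apply/unit_sphereE; rewrite norm2Z ger0_norm ?invr_ge0 ?ltW // mulVf // gt_eqF.
have agree (x : 'rV[R]_j.+1) : norm2 x = 1/2 -> h x = g1 (2 *: x).
  move=> e; have e2 : u x = 2 *: x by rewrite /u e div1r invrK.
  rewrite g1f; last by rewrite -e2; apply: outer_sphere; split; lra.
  apply: funext => v; rewrite /h e2 /s e.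
  by rewrite (_ : 2 * (1/2) - 1 = 0 :> R); [rewrite subr0 mul1r mul0r addr0|lra].
have ch : {within outer, continuous h}.
  have cu : {within outer, continuous u}.
    apply: scale_within; apply: withinV; first exact: norm2_within.
    by move=> x [x2 _]; rewrite gt_eqF //; lra.
  have cs : {within outer, continuous s}.
    apply: withinB; last exact: within_cst.
    by apply: withinM; [exact: within_cst|exact: norm2_within].
  apply/within_ptws => v; apply: withinD; apply: withinM => //.
  - by apply: withinB => //; exact: within_cst.
  - have /within_ptws := within_comp cu outer_sphere c1; exact.
  - have /within_ptws := within_comp cu outer_sphere c0; exact.
exists (fun x : 'rV[R]_j.+1 => if norm2 x <= 1/2 then g1 (2 *: x) else h x); split.
- have -> : unit_disk R j.+1 = inner `|` outer.
    apply/seteqP; split=> x.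
      move/unit_diskE => x1; have [xi|xo] := leP (norm2 x) (1/2); first by left.
      by right; split=> //; exact: ltW.
    by move=> [xi|[_ xo]]; apply/unit_diskE => //; have : norm2 x <= 1/2 := xi; lra.
  apply: withinU_continuous.
  + exact: (closed_norm2 (@closed_le R (1/2))).
  + exact: (closed_norm2 (closedI (@closed_ge R (1/2)) (@closed_le R 1))).
  + apply: (eq_within (f := fun x : 'rV[R]_j.+1 => g1 (2 *: x))) => [x /= ->//|].
    apply: (@within_comp _ _ _ _ (unit_disk R j.+1) (fun x : 'rV[R]_j.+1 => 2 *: x)) => //.
      by apply: scale_within; exact: within_cst.
    by move=> x xi; apply/unit_diskE; have : norm2 x <= 1/2 := xi; rewrite norm2Z ger0_norm //; lra.
  + apply: (eq_within (f := h)) => // x [x2 _].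
    by case: leP => // x2'; apply: agree; lra.
- move=> _ [x /unit_diskE x1 <-]; case: leP => xi.
    by apply: g1K; exists (2 *: x) => //; apply/unit_diskE; rewrite norm2Z ger0_norm //; lra.
  have xo : outer x by split=> //; exact: ltW.
  apply: realization_segment => //.
  + by apply: f1K; exists (u x) => //; exact: outer_sphere.
  + by apply: f0K; exists (u x) => //; exact: outer_sphere.
  + by apply: f01; exact: outer_sphere.
  + by rewrite /s; lra.
- move=> x /[dup] xS /unit_sphereE x1; rewrite x1 ifF; last by apply/negbTE; rewrite -ltNge; lra.
  apply: funext => v; rewrite /h /u /s x1 invr1 scale1r.
  by rewrite (_ : 2 * 1 - 1 = 1 :> R); [rewrite subrr mul0r mul1r add0r|lra].
Qed.

(** The complex [L] stays fixed while [K] shrinks to a point in the induction on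
    collapses, so the filling is sought in [L] and not in [K]. *)
Definition spheres_null (j : nat) K L : Prop :=
  forall f : 'rV[R]_j.+1 -> {ptws V -> R},
    {within unit_sphere R j.+1, continuous f} ->
    f @` unit_sphere R j.+1 `<=` realization R K -> null_in L f.

Lemma realization_sub K L : K \subset L -> realization R K `<=` realization R L.
Proof. by move=> /fintype.subsetP KL x [x0 x1 xK]; split=> //; exact: KL. Qed.

(** The map [r] retracts the realization of [K] to that of [K'] by pushing each
    point of the simplex [p |: rho] away from the barycentre of the free face
    [rho], towards [p], until a coordinate in [rho] vanishes.  A point and its image
    lie in a common simplex. *)
Lemma spheres_null_collapse (j : nat) (K L : {set {set V}}) (rho : {set V}) (p : V) :
    simplicial_complex K -> simplicial_complex L -> K \subset L ->
    p \notin rho -> rho != finset.set0 -> (p |: rho)%SET \in K ->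
    (forall t, t \in K -> rho \subset t -> t = rho \/ t = (p |: rho)%SET) ->
  spheres_null j (K :\ (p |: rho) :\ rho)%SET L -> spheres_null j K L.
Proof.
move=> [_ down] Lc KL prho rho0 prK free.
set K' := (K :\ _ :\ _)%SET => nullK' f cf fK.
have K'K : K' \subset K by exact: fintype.subset_trans (subsetDl _ _) (subsetDl _ _).
have KK' t : t \in K -> t != rho -> t != (p |: rho)%SET -> t \in K'.
  by move=> tK tr tpr; rewrite !inE tr tpr.
have [q0 q0rho] : exists q, q \in rho by exact/set0Pn.
(* The least coordinate in [rho]: zero off the two simplices that are removed. *)
pose t x : R := \big[Num.min/x q0]_(q in rho) x q.
have t_le x q : q \in rho -> t x <= x q by move=> qr; exact: bigmin_le_cond.
have t_ge0 x : (forall v, 0 <= x v) -> 0 <= t x by move=> x0; apply: le_bigmin.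
have t_att x : exists2 q, q \in rho & t x = x q.
  rewrite /t; apply: (big_ind (fun z => exists2 q, q \in rho & z = x q)).
  - by exists q0.
  - move=> _ _ [q qr ->] [q' q'r ->].
    by case: (leP (x q) (x q')) => _; [exists q|exists q'].
  - by move=> q qr; exists q.
pose r x : {ptws V -> R} := fun v =>
  x v - (if v \in rho then t x else 0) + (if v == p then #|rho|%:R * t x else 0).
have r_ge0 x v : (forall v, 0 <= x v) -> 0 <= r x v.
  move=> x0; rewrite /r addr_ge0 //; last first.
    by case: ifP => // _; rewrite mulr_ge0 ?ler0n ?t_ge0.
  by case: ifP => vr; rewrite subr_ge0 ?t_le ?x0.
have r_sum x : \sum_v r x v = \sum_v x v.
  rewrite /r big_split sumrB -!big_mkcond /= big_pred1_eq sumr_const.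
  by rewrite mulr_natl subrK.
have r_supp x : realization R K x ->
    carrier (r x) \in K' /\ (carrier (r x) :|: carrier x)%SET \in K.
  move=> [x0 x1 xK].
  have [q qr tq] := t_att x.
  have npq : q != p by apply: contraNneq prho => <-.
  have [t0|tpos] : t x = 0 \/ 0 < t x.
    by have := t_ge0 x x0; rewrite le_eqVlt => /orP[/eqP<-|]; [left|right].
  - have -> : r x = x.
      by apply: funext => v; rewrite /r t0 mulr0 !if_same subr0 addr0.
    have xq : q \notin carrier x by rewrite inE negbK -tq t0.
    split; last by rewrite finset.setUid.
    apply: KK' => //; apply: contraNneq xq => e; rewrite e //.
    by rewrite finset.inE qr orbT.
  - have rx : rho \subset carrier x.
      apply/fintype.subsetP => v vr; rewrite inE gt_eqF //.
      exact: lt_le_trans tpos (t_le _ _ vr).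
    have sx : carrier x \subset (p |: rho)%SET.
      by rewrite /carrier; case: (free _ xK rx) => ->; rewrite ?finset.subsetUr.
    have srx : carrier (r x) \subset (p |: rho)%SET.
      apply/fintype.subsetP => v; rewrite !inE; apply: contraNT; rewrite negb_or.
      move=> /andP[/negbTE vp /negbTE vr]; rewrite /r vp vr subr0 addr0.
      by apply: contraTT sx => xv; apply/subsetPn; exists v; rewrite !inE ?vp ?vr.
    have nq : q \notin carrier (r x).
      by rewrite inE /r qr (negbTE npq) addr0 tq subrr eqxx.
    split; first apply: KK'.
    + exact: down srx prK.
    + by apply: contraNneq nq => e; rewrite e.
    + by apply: contraNneq nq => e; rewrite e !inE qr orbT.
    + by apply: down prK; rewrite finset.subUset srx.
have r_K' x : realization R K x -> realization R K' (r x).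
  move=> xK; have [rK' _] := r_supp x xK; case: xK => x0 x1 _.
  by split; [move=> v; exact: r_ge0|rewrite r_sum|].
have cr : {within setT, continuous r}.
  have cv v : {within setT, continuous (fun x => x v)}.
    by apply: continuous_subspaceT; exact: (@proj_continuous V (fun=> R) v).
  have ct : {within setT, continuous t}.
    by apply: within_bigmin.
  apply/within_ptws => v; apply: withinD.
    by apply: withinB; [exact: cv|case: (v \in rho); [exact: ct|exact: within_cst]].
  case: (v == p); last exact: within_cst.
  by apply: withinM; [exact: within_cst|exact: ct].
have crf : {within unit_sphere R j.+1, continuous (r \o f)}.
  exact: (within_comp cf _ cr).
apply: (null_in_homotopy Lc cf crf).
- by apply: subset_trans fK _; exact: realization_sub.
- move=> _ [x xS <-]; apply: (realization_sub (fintype.subset_trans K'K KL)).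
  by apply: r_K'; apply: fK; exists x.
- move=> x xS; have /= fxK : realization R K (f x) by apply: fK; exists x.
  by have [_ /(fintype.subsetP KL)] := r_supp _ fxK.
- apply: nullK' => //; move=> _ [x xS <-]; apply: r_K'; apply: fK; by exists x.
Qed.

End Realization.

(** * Approximation by a map into a skeleton *)

Section Grid.

Variables (R : realType) (d N : nat).
Implicit Types u : 'rV[R]_d.

(** The points of the cube [[-1, 1]^d] whose coordinates are multiples of
    [1 / N]; the nonnegative integer [a i] stands for the coordinate
    [a i / N - 1]. *)
Definition grid : finType := {ffun 'I_d -> 'I_(N.*2).+1}.
Implicit Types a b : grid.

(** The extra index [None] adds a coordinate that is constantly zero, so that
    bounds on differences of offsets include bounds on offsets. *)
Definition offset a u (o : option 'I_d) : R :=
  if o is Some i then N%:R * (u ord0 i + 1) - (a i)%:R else 0.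

(** Positive exactly where the offsets, zero included, lie in an interval of
    length less than one; this is the open star of [a] in Freudenthal's triangulation
    of the cube.  Divided by their sum, these functions form a partition of unity. *)
Definition hat a u : R :=
  \prod_(p : option 'I_d * option 'I_d) Num.max 0 (1 - (offset a u p.1 - offset a u p.2)).

Lemma hat_ge0 a u : 0 <= hat a u.
Proof. by apply: prodr_ge0 => p _; rewrite le_max lexx. Qed.

Lemma hat_neq0P a u :
  reflect (forall p q, offset a u p - offset a u q < 1) (hat a u != 0).
Proof.
apply: (iffP (prodf_neq0 _ _ )) => [H p q|H [p q] _ /=].
  have := H (p, q) isT; apply: contraTT; rewrite -leNgt => le /=.
  by rewrite negbK; apply/eqP/max_idPl; lra.
by rewrite gt_eqF // lt_max subr_gt0 H orbT.
Qed.

Lemma nat_close (p q : nat) : p%:R - q%:R < 1 :> R -> q%:R - p%:R < 1 :> R -> p = q.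
Proof.
rewrite ltrBlDr addrC natr1 ltr_nat ltnS => pq.
rewrite ltrBlDr addrC natr1 ltr_nat ltnS => qp.
by apply/eqP; rewrite eqn_leq pq.
Qed.

(** The nonzero hat functions are counted by the index [e a] of a least offset.
    This offset lies between -1 and 0, which determines it from [u] and the index;
    the other offsets exceed it by less than 1, which determines them from [u], and
    with them [a].  On the boundary of the cube one coordinate is 1 or -1, hence an
    integer multiple of [1 / N], and its offset is zero; so a least offset occurs at
    a coordinate, and [None] need not be counted.  This saves one hat function: at
    most [d] vertices are used on the sphere, which has dimension [d - 1]. *)
Lemma card_hat u i : `|u ord0 i| = 1 -> (#|[set a | hat a u != 0%R]%SET| <= d)%N.
Proof.
move=> ui1.
have off0 a : hat a u != 0 -> offset a u (Some i) = 0.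
  move=> /hat_neq0P H; have := H (Some i) None; have := H None (Some i); rewrite /= subr0 sub0r.
  have [n ->] : exists n : nat, N%:R * (u ord0 i + 1) = n%:R :> R.
    move/eqP: ui1; rewrite eqr_norml => /andP[/orP[]/eqP -> _].
      by exists (N * 2)%N; rewrite natrM.
    by exists 0%N; rewrite addNr mulr0.
  by rewrite opprB => lt1 lt2; rewrite (nat_close lt2 lt1) subrr.
pose e a := [arg min_(l < i) offset a u (Some l)]%O.
have e_min a l : offset a u (Some (e a)) <= offset a u (Some l).
  by rewrite /e; case: arg_minP => // m _; apply.
rewrite -[leqRHS]card_ord -(card_in_imset (f := e)) ?max_card //.
move=> a b; rewrite !inE => ha hb eab.
have ta := e_min a i; have tb := e_min b i.
rewrite (off0 a ha) in ta; rewrite (off0 b hb) -eab in tb.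
move/hat_neq0P: ha => ha; move/hat_neq0P: hb => hb.
have eq : a (e a) = b (e a) :> nat.
  have := ha None (Some (e a)); have := hb None (Some (e a)).
  by move: ta tb => /=; rewrite !sub0r => *; apply: nat_close; lra.
apply/ffunP => l; apply: val_inj => /=.
have := ha (Some l) (Some (e a)); have := hb (Some l) (Some (e a)).
have := e_min a l; have := e_min b l; rewrite -eab /= eq => *.
by apply: nat_close; lra.
Qed.

Lemma exists_hat u : (forall i, `|u ord0 i| <= 1) -> exists a, hat a u != 0.
Proof.
move=> u1; exists [ffun i => inord (Num.trunc (N%:R * (u ord0 i + 1)))].
set a := [ffun i => _].
suff off p : 0 <= offset a u p < 1.
  by apply/hat_neq0P => p q; have := off p; have := off q; lra.
case: p => [i|] /=; last by rewrite lexx ltr01.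
have /ler_normlP[lo hi] := u1 i.
have x0 : 0 <= N%:R * (u ord0 i + 1) by apply: mulr_ge0 => //; lra.
have le2 : N%:R * (u ord0 i + 1) <= N%:R * 2 by apply: ler_wpM2l => //; lra.
rewrite ffunE inordK; last first.
  rewrite ltnS truncn_le_nat (le_lt_trans le2) //.
  by rewrite -natrM ltr_nat muln2.
have /andP[] := truncn_itv x0; rewrite -natr1; lra.
Qed.

Lemma hat_close a u u' i : hat a u != 0 -> hat a u' != 0 ->
  N%:R * `|u ord0 i - u' ord0 i| < 2.
Proof.
move=> /hat_neq0P H /hat_neq0P H'.
rewrite -[N%:R]ger0_norm // -normrM ltr_norml mulrBr.
have := H (Some i) None; have := H None (Some i).
have := H' (Some i) None; have := H' None (Some i); rewrite /=; lra.
Qed.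

Lemma hat_within (A : set 'rV[R]_d) a : {within A, continuous (hat a)}.
Proof.
apply: within_prod => -[p q]; apply: within_max; first exact: within_cst.
apply: withinB; first exact: within_cst.
have co o1 : {within A, continuous (fun u => offset a u o1)}.
  case: o1 => [i|] /=; last exact: within_cst.
  apply: withinB; last exact: within_cst.
  apply: withinM; first exact: within_cst.
  by apply: withinD; [exact: coord_within|exact: within_cst].
by apply: withinB; exact: co.
Qed.

End Grid.

Section SupNorm.

Variables (R : realType) (d : nat).
Implicit Types u : 'rV[R]_d.

Lemma sup_norm_attained u : u != 0 -> exists i, `|u| = `|u ord0 i|.
Proof.
move=> u0; have /mx_norm_neq0 [[i j] /= e] : mx_norm u != 0.
  by apply: contra u0 => /eqP /mx_norm_eq0 ->.
by exists j; rewrite [LHS]e (ord1 i).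
Qed.

Lemma coord_le_norm u i : `|u ord0 i| <= `|u|.
Proof. by rewrite [leRHS]mx_normrE; apply/bigmax_geP; right; exists (ord0, i). Qed.

Lemma sup_norm_lt u (e : R) : 0 < e -> (forall i, `|u ord0 i| < e) -> `|u| < e.
Proof.
move=> e0 H; have [->|u0] := eqVneq u 0; first by rewrite normr0.
by have [i ->] := sup_norm_attained u0.
Qed.

Lemma compact_sup_sphere : compact [set u : 'rV[R]_d | `|u| = 1].
Proof.
apply: bounded_closed_compact.
  by exists 1; split=> // M M1 u /= ->; exact: ltW.
have -> : [set u : 'rV[R]_d | `|u| = 1] = Num.norm @^-1` [set 1 : R] by [].
by apply: preimage_closed => [x _|]; [exact: norm_continuous|exact: closed_eq].
Qed.

Lemma uniformly_close (V : finType) (Q : set 'rV[R]_d) (F : 'rV[R]_d -> V -> R) (e : R) :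
    compact Q -> (forall v, {within Q, continuous (F ^~ v)}) -> 0 < e ->
  exists2 delta : R, 0 < delta &
    forall u u', Q u -> Q u' -> `|u - u'| < delta -> forall v, `|F u v - F u' v| < e.
Proof.
move=> cQ cF e0.
have /compact_near_coveringP/near_covering_withinP cov := cQ.
pose P (delta : R) u := forall u', Q u' -> `|u - u'| < delta ->
  forall v, `|F u v - F u' v| < e.
have /cov : forall u, Q u -> \forall u' \near u & delta \near 0^'+, Q u' -> P delta u'.
  move=> u Qu.
  have : \forall y \near within Q (nbhs u), forall v, `|F u v - F y v| < e / 2.
    apply: filter_forall => v; have /subspace_continuousP /(_ u Qu) := cF v.
    by move/cvgrPdist_lt; apply; rewrite divr_gt0.
  rewrite near_withinE => /nbhs_ballP[eta /= eta0 near_u].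
  exists (ball u (eta / 2), [set delta | delta < eta / 2]).
    split; first by apply: nbhsx_ballx; rewrite divr_gt0.
    by apply: nbhs_right_lt; rewrite divr_gt0.
  move=> [y delta] /= [uy deltaeta] Qy y' Qy' yy' v.
  have Fy : `|F u v - F y v| < e / 2.
    by apply: near_u => //; apply: le_ball uy; lra.
  have Fy' : `|F u v - F y' v| < e / 2.
    apply: near_u => //; move: uy; rewrite -!ball_normE /= => uy.
    rewrite -(subrK y u) -addrA (le_lt_trans (ler_normD _ _)) //; lra.
  rewrite (_ : F y v - F y' v = (F u v - F y' v) - (F u v - F y v)); last by ring.
  by rewrite (le_lt_trans (ler_normB _ _)) //; lra.
move=> near0.
have : \forall delta \near (0 : R)^'+, 0 < delta /\ (Q `<=` P delta).
  by near=> delta; split; near: delta; [exact: nbhs_right_gt|exact: near0].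
move=> /filter_ex [delta [delta0 QP]]; exists delta => // u u' Qu Qu' uu'.
exact: QP.
Unshelve. all: by end_near. Qed.

End SupNorm.

Section SkeletalApproximation.

Variables (R : realType) (V : finType) (v0 : V) (j : nat).
Notation d := j.+1.

(** The sphere is identified with the boundary of the cube.  On a fine grid each
    hat function has its support, within that boundary, inside some [F u v != 0];
    [w a] is such a vertex [v].  The map with barycentric coordinates given by the
    normalized hat functions, [a] being sent to the vertex [w a], takes values in
    the simplex spanned by the carrier of [f x], and uses at most as many vertices
    as there are nonzero hat functions. *)
Lemma skeletal_approximation (f : 'rV[R]_d -> {ptws V -> R}) :
    {within unit_sphere R d, continuous f} ->
    (forall x, unit_sphere R d x -> (forall v, 0 <= f x v) /\ \sum_v f x v = 1) ->
  exists f' : 'rV[R]_d -> {ptws V -> R},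
    {within unit_sphere R d, continuous f'} /\
    forall x, unit_sphere R d x ->
      [/\ forall v, 0 <= f' x v, \sum_v f' x v = 1,
          carrier (f' x) \subset carrier (f x) & (#|carrier (f' x)| <= d)%N].
Proof.
move=> cf f_simplex.
pose Q := [set u : 'rV[R]_d | `|u| = 1].
pose F (u : 'rV[R]_d) := f ((norm2 u)^-1 *: u).
have Q0 u : Q u -> u != 0 by move=> u1; rewrite -normr_gt0 u1.
have F_sphere u : Q u -> unit_sphere R d ((norm2 u)^-1 *: u).
  move=> /Q0 /norm2_gt0 u0; apply/unit_sphereE.
  by rewrite norm2Z ger0_norm ?invr_ge0 ?ltW // mulVf // gt_eqF.
have cF : {within Q, continuous F}.
  apply: (within_comp _ F_sphere cf); apply: scale_within.
  apply: withinV; first exact: norm2_within.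
  by move=> u /Q0 /norm2_gt0; rewrite lt0r => /andP[].
have V0 : 0 < #|V|%:R :> R by rewrite ltr0n; apply/card_gt0P; exists v0.
have [||delta delta0 F_close] :=
  @uniformly_close _ _ V Q F (#|V|%:R^-1) (@compact_sup_sphere _ _).
- by move=> v; have /within_ptws := cF; apply.
- by rewrite invr_gt0.
pose N := (Num.trunc (2 / delta)).+1.
have N2 : 2 < N%:R * delta by rewrite -ltr_pdivrMr // truncnS_gt.
have hat_F a u u' : Q u -> Q u' -> hat (N := N) a u != 0 -> hat a u' != 0 ->
    forall v, `|F u v - F u' v| < #|V|%:R^-1.
  move=> Qu Qu' au au'; apply: F_close => //; apply: sup_norm_lt => // i.
  rewrite !mxE -(ltr_pM2l (_ : 0 < N%:R)) ?ltr0n //.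
  exact: lt_trans (hat_close i au au') N2.
have [w w_supp] : {w : grid d N -> V &
    forall a u, Q u -> hat a u != 0 -> F u (w a) != 0}.
  apply: (@boolp.choice (grid d N) V (fun a v => forall u, Q u -> hat a u != 0 -> F u v != 0)) => a.
  have [[u Qu au]|none] := pselect (exists2 u, Q u & hat a u != 0); last first.
    by exists v0 => u Qu au; exfalso; apply: none; exists u.
  have [v Fv] : exists v, #|V|%:R^-1 <= F u v.
    apply: contrapT => /forallNP small; have [_ sum1] := f_simplex _ (F_sphere u Qu).
    have : \sum_v F u v < \sum_(v : V) #|V|%:R^-1.
      apply: ltr_sum; first by apply/hasP; exists v0; rewrite ?mem_index_enum.
      by move=> v _; rewrite ltNge; apply/negP/small.
    by rewrite sum1 sumr_const -[ltRHS]mulr_natr mulVf ?ltxx // gt_eqF.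
  exists v => u' Qu' au'; have := hat_F a u u' Qu Qu' au au' v.
  by move=> /ltr_normlP[_ close]; rewrite gt_eqF //; lra.
pose U (x : 'rV[R]_d) := `|x|^-1 *: x.
have x_neq0 x : unit_sphere R d x -> x != 0.
  move=> /unit_sphereE x1; apply: contra_eq_neq x1 => ->.
  by rewrite -[0](scale0r (0 : 'rV[R]_d)) norm2Z normr0 mul0r eq_sym oner_neq0.
have QU x : unit_sphere R d x -> Q (U x).
  by move=> /x_neq0 x0; rewrite /Q /U /= normrZ normfV normr_id mulVf // normr_eq0.
have FU x : unit_sphere R d x -> F (U x) = f x.
  move=> xS; have x0 := x_neq0 x xS; move/unit_sphereE: xS => x1.
  rewrite /F /U norm2Z x1 mulr1 ger0_norm ?invr_ge0 // invrK scalerA divff ?scale1r //.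
  by rewrite normr_eq0.
pose total x := \sum_(a : grid d N) hat a (U x).
have total_gt0 x : unit_sphere R d x -> 0 < total x.
  move=> /QU u1; have [a au] : exists a : grid d N, hat a (U x) != 0.
    by apply: exists_hat => i; rewrite -u1 coord_le_norm.
  rewrite /total (bigD1 a) //= ltr_pwDl ?sumr_ge0 // ?lt_def ?au ?hat_ge0 // => *.
  exact: hat_ge0.
pose f' x : {ptws V -> R} := fun v => (\sum_(a | w a == v) hat a (U x)) / total x.
have cU : {within unit_sphere R d, continuous U}.
  apply: scale_within; apply: withinV.
    by apply: continuous_subspaceT; exact: norm_continuous.
  by move=> x /x_neq0; rewrite normr_eq0.
have chat a : {within unit_sphere R d, continuous (fun x => hat (N := N) a (U x))}.
  have := within_comp cU QU (@hat_within R d N Q a); exact.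
exists f'; split.
  apply/within_ptws => v; apply: withinM; first exact: within_sum.
  apply: withinV; first exact: within_sum.
  by move=> x /total_gt0 /lt0r_neq0.
move=> x xS; have t0 := total_gt0 x xS.
have supp_w v : v \in carrier (f' x) -> exists2 a, w a = v & hat a (U x) != 0.
  rewrite inE => nz; apply: contrapT => none; move/negP: nz; apply; apply/eqP.
  rewrite /f' big1 ?mul0r // => a /eqP wa; apply/eqP/negPn/negP => au.
  by apply: none; exists a.
split.
- by move=> v; rewrite divr_ge0 ?(ltW t0) // sumr_ge0 // => a _; exact: hat_ge0.
- rewrite /f' -mulr_suml.
  have <- : total x = \sum_v \sum_(a | w a == v) hat a (U x).
    by rewrite /total (partition_big w xpredT).
  by rewrite divff // lt0r_neq0.
- apply/fintype.subsetP => v /supp_w[a <- au].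
  by rewrite inE -FU //; apply: w_supp => //; exact: QU.
- have [i ui] := sup_norm_attained (Q0 _ (QU x xS)).
  have sub : carrier (f' x) \subset w @: [set a | hat a (U x) != 0]%SET.
    by apply/fintype.subsetP => v /supp_w[a <- au]; apply: imset_f; rewrite inE.
  apply: leq_trans (subset_leq_card sub) _; apply: leq_trans (leq_imset_card _ _) _.
  by apply: (@card_hat _ _ _ _ i); rewrite -ui; exact: QU.
Qed.

End SkeletalApproximation.

Lemma realization_point (R : realType) (V : finType) (K : {set {set V}}) p :
  [set p]%SET \in K -> realization R K (fun v => if v == p then 1%R else 0%R).
Proof.
move=> pK; split.
- by move=> v; case: ifP => _; rewrite ?ler01.
- by rewrite -big_mkcond /= big_pred1_eq.
- rewrite (_ : [set v | _]%SET = [set p]%SET) //; apply/setP => v.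
  by rewrite !inE; case: (v == p); rewrite ?oner_neq0 ?eqxx.
Qed.

(** * Acyclic matchings *)

(** Attaching a simplex of dimension greater than [j] creates no new [j]-spheres,
    because a sphere can be pushed into the [j]-skeleton. *)
Lemma spheres_null_facet (R : realType) (V : finType) (j : nat) (K L : {set {set V}})
    (S : {set V}) :
    simplicial_complex L -> simplicial_complex K -> L \subset K -> (j.+1 < #|S|)%N ->
  spheres_null R j (L :\ S)%SET K -> spheres_null R j L K.
Proof.
move=> [_ down] Kc LK Sj null f cf fL.
have /card_gt0P [v0 _] : (0 < #|S|)%N by exact: leq_ltn_trans Sj.
have [|f' [cf' f'P]] := skeletal_approximation v0 cf.
  by move=> x xS; have [f0 f1 _] : realization R L (f x) by apply: fL; exists x.
have fxL x : unit_sphere R j.+1 x -> realization R L (f x) by move=> xS; apply: fL; exists x.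
have f'L' : f' @` unit_sphere R j.+1 `<=` realization R (L :\ S)%SET.
  move=> _ [x xS <-]; have [f'0 f'1 sub small] := f'P x xS; split=> //.
  have [_ _ fxS] := fxL x xS; rewrite finset.in_setD1 (down _ _ sub fxS) andbT.
  by apply: contraTneq small => e; rewrite /carrier e -ltnNge.
apply: (null_in_homotopy Kc cf cf').
- by apply: subset_trans fL _; exact: realization_sub.
- apply: subset_trans f'L' _; apply: realization_sub.
  exact: fintype.subset_trans (subsetDl _ _) LK.
- move=> x xS; have [_ _ sub _] := f'P x xS; rewrite (finset.setUidPr sub).
  by apply: (fintype.subsetP LK); have [] := fxL x xS.
- exact: null.
Qed.

(** Comparable faces of equal rank differ by the one vertex [switch S] only, and
    this makes the matching of [S] with [toggle S (switch S)] acyclic.  Faces with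
    more than [N] elements may be unmatched. *)
Section Morse.

Variables (R : realType) (V : finType) (disp : Order.disp_t) (O : orderType disp).
Variables (K : {set {set V}}) (N : nat) (rank : {set V} -> O) (switch : {set V} -> V).
Hypothesis K_complex : simplicial_complex K.
Hypothesis rank_mono : forall S T, S \in K -> T \in K -> S \subset T -> (rank S <= rank T)%O.
Hypothesis rank_strict : forall S T, S \in K -> T \in K -> S \subset T -> S != T ->
  rank S = rank T -> T = (switch S |: S)%SET.
Hypothesis matched : forall S, S \in K -> (#|S| <= N)%N ->
  [/\ toggle S (switch S) \in K, rank (toggle S (switch S)) = rank S &
      switch (toggle S (switch S)) = switch S].

Local Notation mate S := (toggle S (switch S)).

Lemma mateK S : S \in K -> (#|S| <= N)%N -> mate (mate S) = S.
Proof. by move=> SK SN; have [_ _ ->] := matched SK SN; exact: toggleK. Qed.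

(** The complex [L] is taken apart from the top: a face [S] of maximal rank, and of
    maximal size among those, is a facet.  If it is the partner of a face [T], then
    [T] is a free face of it, since a face above [T] cannot have a larger rank, and
    the pair is collapsed; when [T] is empty, [L] is a point.  Otherwise [S] has more
    than [N] elements and is removed as a facet. *)
Lemma spheres_null_matched j (L : {set {set V}}) : (j.+1 <= N)%N ->
    L \subset K -> simplicial_complex L ->
    (forall S, S \in L -> (#|S| <= N)%N -> mate S \in L) ->
  spheres_null R j L K.
Proof.
move=> jN; have [n] := ubnP #|L|; elim: n L => // n IH L Ln LK Lc closed.
have [L0 down] := Lc.
have LinK S : S \in L -> S \in K by exact: (fintype.subsetP LK).
pose S1 := [arg max_(S > finset.set0 in L) rank S]%O.
have [S1L S1max] : S1 \in L /\ forall S, S \in L -> (rank S <= rank S1)%O.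
  by rewrite /S1; case: arg_maxP => // S SL Smax; split.
pose S := [arg max_(S > S1 | (S \in L) && (rank S == rank S1)) #|S|].
have [SL rS Smax] : [/\ S \in L, rank S = rank S1 &
    forall T, T \in L -> rank T = rank S1 -> (#|T| <= #|S|)%N].
  rewrite /S; case: arg_maxnP => [|T /andP[TL /eqP rT] Tmax]; first by rewrite S1L eqxx.
  by split=> // T' T'L rT'; apply: Tmax; rewrite T'L rT' eqxx.
have {}S1max T : T \in L -> (rank T <= rank S)%O by rewrite rS; exact: S1max.
have {}Smax T : T \in L -> rank T = rank S -> (#|T| <= #|S|)%N by rewrite rS; exact: Smax.
clearbody S; clear S1 S1L rS.
have facet T : T \in L -> S \subset T -> T = S.
  move=> TL ST; apply/esym/eqP; rewrite eqEcard ST Smax //.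
  by apply/eqP; rewrite eq_le S1max // rank_mono ?LinK.
have [[T TL [TN TS]]|single] := pselect (exists2 T, T \in L & (#|T| <= N)%N /\ mate T = S).
- have [_ rT pT] := matched (LinK _ TL) TN; rewrite TS in rT pT.
  have pNT : switch T \notin T.
    apply/negP => pin; have TeS : T = S.
      by apply: facet => //; rewrite -TS /toggle pin subsetDl.
    by move: TS; rewrite -TeS => /setP/(_ (switch T)); rewrite in_toggle pin eqxx.
  have defS : S = (switch T |: T)%SET by rewrite -TS /toggle (negbTE pNT).
  have free t : t \in L -> T \subset t -> t = T \/ t = (switch T |: T)%SET.
    move=> tL Tt; have [->|ne] := eqVneq T t; [by left|right].
    apply: rank_strict => //; try exact: LinK.
    by apply/eqP; rewrite eq_le rank_mono ?LinK //= -rT S1max.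
  (* The pair of the empty face is the last one: [L] has a single vertex. *)
  have [T0|T_neq0] := eqVneq T finset.set0.
    move=> f cf fL.
    pose x0 : {ptws V -> R} := fun v => if v == switch T then 1%R else 0%R.
    have fx x : unit_sphere R j.+1 x -> f x = x0.
      move=> xS; have [f0 f1 fxL] : realization R L (f x) by apply: fL; exists x.
      have fv v : v != switch T -> f x v = 0%R.
        move=> ne; have [||e] := free _ fxL; first by rewrite T0 finset.sub0set.
          by move/setP => /(_ v); rewrite T0 !inE => /negbFE/eqP.
        have vT : v \notin T by rewrite T0 inE.
        move/setP: e => /(_ v); rewrite finset.in_set finset.in_setU1.
        by rewrite (negbTE ne) (negbTE vT) => /negbFE/eqP.
      apply: funext => v; rewrite /x0; case: eqVneq => [->|]; last exact: fv.
      by rewrite -f1 (bigD1 (switch T)) //= big1 ?addr0 // => w; exact: fv.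
    exists (fun=> x0); split=> [||x /fx//].
      by apply/within_ptws => v; exact: within_cst.
    move=> _ [x _ <-]; apply: realization_point.
    by rewrite -[[set _]%SET]finset.setU0 -T0 -defS; exact: LinK.
  have pS : switch T \in S by rewrite defS finset.setU11.
  have TneS : T != S by apply: contraNneq pNT => e; rewrite -e in pS.
  have L'L : (L :\ S :\ T)%SET \subset L.
    exact: fintype.subset_trans (subsetDl _ _) (subsetDl _ _).
  apply: (@spheres_null_collapse _ _ j L K T (switch T)) => //; rewrite -defS //.
  apply: IH.
  + have := cardsD1 S L; have := cardsD1 T (L :\ S)%SET.
    rewrite SL finset.in_setD1 TneS TL => -> eL.
    by move: Ln; rewrite eL !add1n ltnS => /ltnW.
  + exact: fintype.subset_trans L'L LK.
  + split=> [|A B AB]; rewrite !inE.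
      rewrite L0 andbT eq_sym T_neq0 /=.
      by apply/eqP => e; move: pS; rewrite -e inE.
    move=> /and3P[BT BS BL]; rewrite (down A B AB BL) andbT.
    apply/andP; split; last by apply: contraNneq BS => AS; apply/eqP/facet => //; rewrite -AS.
    apply: contraNneq BT => AT; rewrite AT in AB.
    by have [->//|e] := free B BL AB; move: BS; rewrite e -defS eqxx.
  + move=> A; rewrite !inE => /and3P[AT AS AL] AN; rewrite closed // andbT.
    have AK := LinK _ AL.
    apply/andP; split; apply/eqP => e.
      by move/eqP: AS; apply; rewrite -(mateK AK AN) e.
    have [_ _ pA] := matched AK AN; rewrite e pT in pA.
    by move/eqP: AT; apply; rewrite -(toggleK A (switch A)) e -pA -TS toggleK.
- have SN : (N < #|S|)%N.
    rewrite ltnNge; apply/negP => SN; apply: single.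
    have [_ _ pS] := matched (LinK _ SL) SN.
    have [pin|pnin] := boolP (switch S \in S).
      exists (mate S); first exact: closed.
      split; last exact: mateK (LinK _ SL) SN.
      by rewrite /toggle pin (leq_trans (subset_leq_card (subsetDl _ _))).
    exfalso; have e : mate S = S.
      by apply: facet; [exact: closed|rewrite /toggle (negbTE pnin) finset.subsetUr].
    by move/setP: e => /(_ (switch S)); rewrite in_toggle (negbTE pnin) eqxx.
  apply: (@spheres_null_facet _ _ j K L S) => //; first exact: leq_ltn_trans SN.
  apply: IH.
  + by move: Ln; rewrite (cardsD1 S) SL.
  + exact: fintype.subset_trans (subsetDl _ _) LK.
  + split=> [|A B AB]; rewrite !inE.
      by rewrite L0 andbT; apply: contraTneq SN => <-; rewrite cards0.
    move=> /andP[BS BL]; rewrite (down A B AB BL) andbT.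
    by apply: contraNneq BS => AS; apply/eqP/facet => //; rewrite -AS.
  + move=> T; rewrite !inE => /andP[TS TL] TN; rewrite closed // andbT.
    by apply/eqP => e; apply: single; exists T.
Qed.

Lemma spheres_null_of_matching j : (j.+1 <= N)%N -> spheres_null R j K K.
Proof.
move=> jN; have [K0 down] := K_complex; apply: spheres_null_matched => //.
by move=> S SK SN; have [] := matched SK SN.
Qed.

Lemma realization_neq0_of_matching : realization R K !=set0.
Proof.
have [K0 _] := K_complex.
have [] := matched K0; rewrite ?cards0 // /toggle inE finset.setU0 => vK _ _.
by eexists; exact: realization_point vK.
Qed.
End Morse.

Local Close Scope classical_set_scope.

(** * Connectivity of the symmetrized deleted join *)

Theorem theorem2p4 (R : realType) (m r k : nat)
    (hm : (1 <= m)%N) (hr : (1 <= r)%N)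
    (K : 'I_r -> {set {set 'I_m}})
    (hK : forall i : 'I_r, simplicial_complex (K i))
    (hunav : collectively_unavoidable K)
    (hbal : forall i : 'I_r, balanced k (K i)) :
  complex_n_connected R (m%:Z - r%:Z - 1) (symm_del_join K).
Proof.
pose i0 := Ordinal hr; pose v0 := Ordinal hm.
have [lt_mr|le_rm] := ltnP m r.
  by split=> [|j]; lia.
have Kc := symm_del_join_complex hK.
have mono S T : S \in symm_del_join K -> T \in symm_del_join K -> S \subset T ->
    (rank_of i0 K S <= rank_of i0 K T)%O.
  by move=> _ _; exact: rank_of_mono.
have strict S T : S \in symm_del_join K -> T \in symm_del_join K -> S \subset T ->
    S != T -> rank_of i0 K S = rank_of i0 K T -> T = (pivot i0 v0 K S |: S)%SET.
  by move=> _ _; exact: rank_of_strict.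
have matched S : S \in symm_del_join K -> (#|S| <= m - r)%N ->
    [/\ toggle S (pivot i0 v0 K S) \in symm_del_join K,
        rank_of i0 K (toggle S (pivot i0 v0 K S)) = rank_of i0 K S &
        pivot i0 v0 K (toggle S (pivot i0 v0 K S)) = pivot i0 v0 K S].
  rewrite leq_subRL // addnC => SX leS; split.
  - exact: (toggle_pivot_face i0 v0 hK hunav hbal SX leS).
  - exact: rank_of_toggle.
  - exact: pivot_toggle.
split=> [_|j jn].
  exact: (realization_neq0_of_matching _ Kc matched).
have jN : (j.+1 <= m - r)%N by lia.
exact (spheres_null_of_matching Kc mono strict matched jN).
Qed.
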